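(* Let $\mathcal N=\{1,\dots,n\}$ be a universe of products with prices $p_1\ge\cdots\ge p_n\ge 0$ and preference weights $v_1,\dots,v_n>0$, let $T\ge 1$ be the number of customers, and let $\ell_i\in\{0,1,\dots,T\}$ for $i\in\mathcal N$. Consider the problem (APV) of choosing assortments $S_1,\dots,S_T\subseteq\mathcal N$ so as to maximize $\sum_{t=1}^T R(S_t)$ subject to $\sum_{t=1}^T \mathbf 1(i\in S_t)\ge \ell_i$ for all $i\in\mathcal N$. For $t\in\{0,1,\dots,T\}$ let $L_t=\{i\in\mathcal N:\ell_i=t\}$, and for $t\in\{1,\dots,T\}$ let $$S_t^*=\left[\!\left[ \bigcup_{t\le u\le T}L_u\right]\!\right] ,$$ where $[\![A]\!]$ denotes the expanded set of $A$. Then the sequence of assortments $(S_t^* )_{1\le t\le T}$ is optimal for (APV). Moreover, such a solution can be computed in $O(n+T)$ time.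
   Context: For an assortment $S\subseteq\mathcal N$, let $V(S)=\sum_{i\in S}v_i$ and let the expected revenue under the Multinomial Logit model be $R(S)=\frac{\sum_{i\in S}p_iv_i}{1+V(S)}$ (the no-purchase option has preference weight $1$). The expanded revenue of $A\subseteq\mathcal N$ is $[\![R]\!](A)=\max\{R(S): A\subseteq S\subseteq\mathcal N\}$. The expanded set $[\![A]\!]$ of $A$ is the assortment $S$ with $A\subseteq S\subseteq\mathcal N$ and $R(S)=[\![R]\!](A)$ that has the largest cardinality among all such assortments (it is unique). *)

(* Defs.v *)
From HB Require Import structures.
From mathcomp Require Import all_boot all_order all_algebra.

Set Implicit Arguments.
Unset Strict Implicit.
Unset Printing Implicit Defensive.

Import Order.TTheory GRing.Theory Num.Theory.
Local Open Scope ring_scope.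

(* Products 1, ..., n are the elements of 'I_n: i : 'I_n is product i + 1.
   Customers keep their numbers 1, ..., T: a sequence of assortments is a
   function S : nat -> {set 'I_n} of which only S 1, ..., S T matter. *)

Definition revenue (R : realFieldType) (n : nat) (p v : 'I_n -> R)
    (S : {set 'I_n}) : R :=
  (\sum_(i in S) p i * v i) / (1 + \sum_(i in S) v i).

(* The maximum is over a nonempty family that contains A, so the default
   value revenue p v A does not affect it. *)
Definition expanded_revenue (R : realFieldType) (n : nat) (p v : 'I_n -> R)
    (A : {set 'I_n}) : R :=
  \big[Num.max/revenue p v A]_(S : {set 'I_n} | A \subset S) revenue p v S.

Definition expanded_candidate (R : realFieldType) (n : nat) (p v : 'I_n -> R)
    (A S : {set 'I_n}) : bool :=
  (A \subset S) && (revenue p v S == expanded_revenue p v A).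

(* The default A is irrelevant, since a candidate always exists: see
   expanded_setP, and expanded_set_unique for uniqueness. *)
Definition expanded_set (R : realFieldType) (n : nat) (p v : 'I_n -> R)
    (A : {set 'I_n}) : {set 'I_n} :=
  [arg max_(S > A | expanded_candidate p v A S) #|S|].

Definition apv_instance (R : realFieldType) (n T : nat) (p v : 'I_n -> R)
    (l : 'I_n -> nat) : Prop :=
  [/\ (1 <= T)%N,
      forall i j : 'I_n, (i <= j)%N -> p j <= p i,
      forall i, 0 <= p i,
      forall i, 0 < v i
    & forall i, (l i <= T)%N].

Definition apv_feasible (n T : nat) (l : 'I_n -> nat)
    (S : nat -> {set 'I_n}) : Prop :=
  forall i, (l i <= \sum_(1 <= t < T.+1) (i \in S t))%N.

Definition apv_value (R : realFieldType) (n T : nat) (p v : 'I_n -> R)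
    (S : nat -> {set 'I_n}) : R :=
  \sum_(1 <= t < T.+1) revenue p v (S t).

Definition apv_optimal (R : realFieldType) (n T : nat) (p v : 'I_n -> R)
    (l : 'I_n -> nat) (S : nat -> {set 'I_n}) : Prop :=
  apv_feasible T l S /\
  forall S' : nat -> {set 'I_n}, apv_feasible T l S' ->
    apv_value T p v S' <= apv_value T p v S.

Definition level (n : nat) (l : 'I_n -> nat) (t : nat) : {set 'I_n} :=
  [set i | l i == t].

Definition opt_assortment (R : realFieldType) (n T : nat) (p v : 'I_n -> R)
    (l : 'I_n -> nat) (t : nat) : {set 'I_n} :=
  expanded_set p v (\bigcup_(t <= u < T.+1) level l u).

(* Running times refer to a real RAM: unit-cost field operations and
   comparisons on reals, and a separate integer sort used for counting and for
   addressing arrays.  There is no conversion from reals to integers, and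
   integers grow only by one unit at a time, so that in time O(n + T) they
   stay in O(n + T): the unit cost model cannot be abused by packing data into
   large integers.  Registers and arrays are named by literals; only array
   cells are addressed indirectly.  The syntax does not depend on the ordered
   field, and the only real literals are 0 and 1. *)
Inductive instr : Type :=
  | NConst (d c : nat)
  | NMove (d x : nat)
  | NSucc (d x : nat)
  | NPred (d x : nat)       (* truncated at 0 *)
  | NLoad (d a x : nat)     (* integer register d := a[x] *)
  | NStore (a x y : nat)    (* a[x] := integer register y *)
  | RZero (d : nat)
  | ROne (d : nat)
  | RMove (d x : nat)
  | RAdd (d x y : nat)
  | RSub (d x y : nat)
  | RMul (d x y : nat)
  | RDiv (d x y : nat)
  | RLoad (d a x : nat)     (* real register d := a[x] *)
  | RStore (a x y : nat).   (* a[x] := real register y *)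

Inductive test : Type :=
  | NLt (x y : nat)
  | NEq (x y : nat)
  | RLe (x y : nat).

Inductive prog : Type :=
  | Skip
  | Instr (c : instr)
  | Seq (c1 c2 : prog)
  | If (b : test) (c1 c2 : prog)
  | While (b : test) (c : prog).

Record state (R : realFieldType) : Type := State {
  nreg : nat -> nat;
  rreg : nat -> R;
  narr : nat -> nat -> nat;
  rarr : nat -> nat -> R
}.

Definition update (X : Type) (f : nat -> X) (k : nat) (x : X) : nat -> X :=
  fun j => if j == k then x else f j.

Definition set_nreg (R : realFieldType) (s : state R) (d : nat) (x : nat) :=
  State (update (nreg s) d x) (rreg s) (narr s) (rarr s).

Definition set_rreg (R : realFieldType) (s : state R) (d : nat) (x : R) :=
  State (nreg s) (update (rreg s) d x) (narr s) (rarr s).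

Definition set_narr (R : realFieldType) (s : state R) (a k : nat) (x : nat) :=
  State (nreg s) (rreg s) (update (narr s) a (update (narr s a) k x)) (rarr s).

Definition set_rarr (R : realFieldType) (s : state R) (a k : nat) (x : R) :=
  State (nreg s) (rreg s) (narr s) (update (rarr s) a (update (rarr s a) k x)).

Definition step (R : realFieldType) (c : instr) (s : state R) : state R :=
  match c with
  | NConst d c => set_nreg s d c
  | NMove d x => set_nreg s d (nreg s x)
  | NSucc d x => set_nreg s d (nreg s x).+1
  | NPred d x => set_nreg s d (nreg s x).-1
  | NLoad d a x => set_nreg s d (narr s a (nreg s x))
  | NStore a x y => set_narr s a (nreg s x) (nreg s y)
  | RZero d => set_rreg s d 0
  | ROne d => set_rreg s d 1
  | RMove d x => set_rreg s d (rreg s x)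
  | RAdd d x y => set_rreg s d (rreg s x + rreg s y)
  | RSub d x y => set_rreg s d (rreg s x - rreg s y)
  | RMul d x y => set_rreg s d (rreg s x * rreg s y)
  | RDiv d x y => set_rreg s d (rreg s x / rreg s y)
  | RLoad d a x => set_rreg s d (rarr s a (nreg s x))
  | RStore a x y => set_rarr s a (nreg s x) (rreg s y)
  end.

Definition holds (R : realFieldType) (b : test) (s : state R) : bool :=
  match b with
  | NLt x y => (nreg s x < nreg s y)%N
  | NEq x y => nreg s x == nreg s y
  | RLe x y => rreg s x <= rreg s y
  end.

(* runs c s k s': started in s, the program c halts in s' after k unit steps. *)
Inductive runs (R : realFieldType) : prog -> state R -> nat -> state R -> Prop :=
  | runs_skip s : runs Skip s 1 s
  | runs_instr c s : runs (Instr c) s 1 (step c s)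
  | runs_seq c1 c2 s s' s'' k1 k2 :
      runs c1 s k1 s' -> runs c2 s' k2 s'' -> runs (Seq c1 c2) s (k1 + k2) s''
  | runs_if_true b c1 c2 s s' k :
      holds b s -> runs c1 s k s' -> runs (If b c1 c2) s k.+1 s'
  | runs_if_false b c1 c2 s s' k :
      ~~ holds b s -> runs c2 s k s' -> runs (If b c1 c2) s k.+1 s'
  | runs_while_false b c s :
      ~~ holds b s -> runs (While b c) s 1 s
  | runs_while_true b c s s' s'' k1 k2 :
      holds b s -> runs c s k1 s' -> runs (While b c) s' k2 s'' ->
      runs (While b c) s (k1 + k2).+1 s''.

Definition array_of (X : Type) (x0 : X) (n : nat) (f : 'I_n -> X) : nat -> X :=
  fun k => if insub k is Some i then f i else x0.

(* Integer registers 0 and 1 hold n and T, real arrays 0 and 1 hold p and v,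
   integer array 0 holds l; all other memory is zero. *)
Definition input_state (R : realFieldType) (n T : nat) (p v : 'I_n -> R)
    (l : 'I_n -> nat) : state R :=
  State
    (fun x => if x == 0%N then n else if x == 1%N then T else 0%N)
    (fun _ => 0)
    (fun a => if a == 0%N then array_of 0%N l else fun _ => 0%N)
    (fun a => if a == 0%N then array_of 0 p
              else if a == 1%N then array_of 0 v else fun _ => 0).

(* Writing T assortments out in full may take n * T cells.  A nested sequence
   S_1 >= ... >= S_T is instead returned as the number c_i of assortments that
   contain each product i, stored in cell i of integer array 1; then
   S_t = {i | t <= c_i}. *)
Definition output_assortment (R : realFieldType) (n : nat) (s : state R)
    (t : nat) : {set 'I_n} :=
  [set i : 'I_n | (t <= narr s 1 i)%N].

Lemma revenue_le_expanded (R : realFieldType) (n : nat) (p v : 'I_n -> R)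
    (A S : {set 'I_n}) :
  A \subset S -> revenue p v S <= expanded_revenue p v A.
Proof. by move=> AS; apply: (le_bigmax_cond (revenue p v A) (revenue p v)). Qed.

Lemma expanded_candidate_exists (R : realFieldType) (n : nat)
    (p v : 'I_n -> R) (A : {set 'I_n}) :
  exists S, expanded_candidate p v A S.
Proof.
rewrite /expanded_candidate.
have [S AS ->] : exists2 S : {set 'I_n},
    A \subset S & expanded_revenue p v A = revenue p v S.
  rewrite /expanded_revenue.
  elim/big_ind: _ => [|x y [S1 AS1 ->] [S2 AS2 ->]|S AS]; [by exists A| |by exists S].
  by case: (leP (revenue p v S1) (revenue p v S2)) => _; [exists S2|exists S1].
by exists S; rewrite AS eqxx.
Qed.

Lemma expanded_setP (R : realFieldType) (n : nat) (p v : 'I_n -> R)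
    (A : {set 'I_n}) :
  [/\ A \subset expanded_set p v A,
      revenue p v (expanded_set p v A) = expanded_revenue p v A
    & forall S : {set 'I_n}, A \subset S ->
        revenue p v S = expanded_revenue p v A ->
        (#|S| <= #|expanded_set p v A|)%N].
Proof.
have [S0 PS0] := expanded_candidate_exists p v A.
have -> : expanded_set p v A = [arg max_(S > S0 | expanded_candidate p v A S) #|S|].
  rewrite /expanded_set /arg_max /extremum; case: pickP => //= noS.
  case: (arg_maxnP (fun S : {set 'I_n} => #|S|) PS0) => S PS maxS.
  have /negP[] := negbT (noS S); rewrite /= PS; apply/forallP => S'.
  by apply/implyP/maxS.
case: arg_maxnP => // S /andP[AS /eqP RS] maxS; split=> // S' AS' RS'.
by apply: maxS; rewrite /expanded_candidate AS' RS' eqxx.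
Qed.

Lemma expanded_set_unique (R : realFieldType) (n : nat) (p v : 'I_n -> R)
    (A S : {set 'I_n}) :
  (forall i, 0 < v i) -> A \subset S ->
  revenue p v S = expanded_revenue p v A ->
  #|S| = #|expanded_set p v A| -> S = expanded_set p v A.
Proof.
move=> v_gt0 AS RS cardS; have [AE RE maxE] := expanded_setP p v A.
set E := expanded_set p v A in cardS AE RE maxE *; set r := expanded_revenue p v A.
pose F (X : {set 'I_n}) := \sum_(i in X) (p i - r) * v i.
have W_gt0 (X : {set 'I_n}) : 0 < 1 + \sum_(i in X) v i.
  by rewrite ltr_pwDl // sumr_ge0 // => i _; apply: ltW.
have FE X : F X = \sum_(i in X) p i * v i - r * \sum_(i in X) v i.
  by rewrite mulr_sumr -sumrB; apply: eq_bigr => i _; rewrite mulrBl.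
have F_le X : (F X <= r) = (revenue p v X <= r).
  by rewrite FE /revenue ler_pdivrMr // mulrDr mulr1 lerBlDr.
have F_eq X : (F X == r) = (revenue p v X == r).
  rewrite !eq_le F_le; congr andb.
  by rewrite FE /revenue ler_pdivlMr // mulrDr mulr1 lerBrDr.
have FUI : F (S :|: E) + F (S :&: E) = F S + F E.
  rewrite /F (big_setID S (A := S :|: E)) setUK setDUl setDv set0U /= -addrA.
  by rewrite [X in _ = _ + X](big_setID S) (setIC E) /= [X in _ + X]addrC.
have maxF (X : {set 'I_n}) : A \subset X -> F X <= r.
  by move=> AX; rewrite F_le; apply: revenue_le_expanded.
have /eqP FS : F S == r by rewrite F_eq RS.
have /eqP FE' : F E == r by rewrite F_eq RE.
have AU : A \subset S :|: E by rewrite subsetU ?AS.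
have AI : A \subset S :&: E by rewrite subsetI AS.
have RU : revenue p v (S :|: E) = r.
  apply/eqP; rewrite -F_eq eq_le maxF //= -(lerD2r (F (S :&: E))) FUI FS FE'.
  by rewrite lerD2l maxF.
have cardU := maxE _ AU RU.
have /eqP EU : E == S :|: E by rewrite eqEcard subsetUr cardU.
by rewrite [RHS]EU; apply/eqP; rewrite eqEcard subsetUl cardS cardU.
Qed.

(* Main.v *)
Require Import Defs.
From mathcomp Require Import all_boot all_order all_algebra.
From mathcomp Require Import zify ring lra.

Set Implicit Arguments.
Unset Strict Implicit.
Unset Printing Implicit Defensive.

Import Order.TTheory GRing.Theory Num.Theory.
Local Open Scope ring_scope.

(** Optimality.  For a fixed number r, comparing R(S) with r is the same as
    comparing the modular function of S given by the sum of (p_i - r) v_i with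
    r ([margin_le], [margin_ge]).  Modularity shows that an assortment which
    is expanded contains every product priced at least its revenue, and that
    replacing two expanded assortments by their union and their intersection
    does not decrease the total revenue ([revenue_uncross]).  Hence the
    expanded revenue, as a function of the set A, is supermodular; it is also
    antitone, since a larger A leaves fewer choices.

    For every supermodular f, the total of f over a family of sets is at most
    its total over the nested family of superlevel sets, whose j-th member
    consists of the points covered at least j times
    ([supermodular_superlevel]).  In a feasible solution, a product with
    l_i >= j is covered at least j times, so by antitonicity the j-th
    superlevel set has an expanded revenue at most that of {i | j <= l_i},
    which is the revenue of the j-th proposed assortment.

    Computation.  The expanded set of A is the only E containing A whose other
    products are exactly the products outside A with a price of at least R(E)
    ([expanded_set_threshold]).  As prices are sorted, the proposed
    assortments have the form {i | t <= l_i or i < m}, and as t decreases A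
    grows, the revenue drops and the prefix length m can only grow.  So one
    monotone walk finds them all: from (t, m), increase m as long as product m
    has a price of at least the current revenue, and decrease t otherwise.
    Each of the n + T + 1 moves takes constant time, because the total value
    and weight of the products that enter when t decreases are available as
    the sums, for each u < t, over the products of level u outside the
    prefix. *)

(** * Revenue and expanded sets *)

Section Revenue.

Variables (R : realFieldType) (n : nat) (p v : 'I_n -> R).
Hypothesis v_gt0 : forall i, 0 < v i.

Implicit Types (A B S X : {set 'I_n}) (r : R).

(** Revenue is a ratio, but its comparisons with a fixed r are comparisons of
    this modular function with r. *)
Definition margin r S : R := \sum_(i in S) (p i - r) * v i.

Lemma weight_gt0 S : 0 < 1 + \sum_(i in S) v i.
Proof. by rewrite ltr_pwDl // sumr_ge0 // => i _; apply: ltW. Qed.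

Lemma marginE r S :
  margin r S = \sum_(i in S) p i * v i - r * \sum_(i in S) v i.
Proof. by rewrite mulr_sumr -sumrB; apply: eq_bigr => i _; rewrite mulrBl. Qed.

Lemma margin_le r S : (margin r S <= r) = (revenue p v S <= r).
Proof.
by rewrite marginE /revenue ler_pdivrMr ?weight_gt0 // mulrDr mulr1 lerBlDr.
Qed.

Lemma margin_ge r S : (r <= margin r S) = (r <= revenue p v S).
Proof.
by rewrite marginE /revenue ler_pdivlMr ?weight_gt0 // mulrDr mulr1 lerBrDr.
Qed.

Lemma margin_revenue S : margin (revenue p v S) S = revenue p v S.
Proof. by apply/eqP; rewrite eq_le margin_le margin_ge lexx. Qed.

Lemma margin_setU1 r S i :
  i \notin S -> margin r (i |: S) = (p i - r) * v i + margin r S.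
Proof. exact: big_setU1. Qed.

Lemma margin_setID r S X :
  margin r S = margin r (S :&: X) + margin r (S :\: X).
Proof. exact: big_setID. Qed.

Lemma margin_le0 r S : (forall i, i \in S -> p i <= r) -> margin r S <= 0.
Proof.
move=> p_le; apply: sumr_le0 => i /p_le pi_le.
by rewrite mulr_le0_ge0 ?subr_le0 // ltW.
Qed.

Lemma margin_ge0 r S : (forall i, i \in S -> r <= p i) -> 0 <= margin r S.
Proof.
move=> p_ge; apply: sumr_ge0 => i /p_ge pi_ge.
by rewrite mulr_ge0 ?subr_ge0 // ltW.
Qed.

(** The new revenue is a weighted mean of the old one and of the price p_i. *)
Lemma revenue_setU1_le S i :
  revenue p v S <= p i -> revenue p v (i |: S) <= p i.
Proof.
have [iS|iS] := boolP (i \in S).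
  by rewrite (setUidPr _) // sub1set.
by rewrite -!margin_le margin_setU1 // subrr mul0r add0r.
Qed.

Lemma revenue_superset_le S X :
  S \subset X -> (forall i, i \in X :\: S -> p i <= revenue p v S) ->
  revenue p v X <= revenue p v S.
Proof.
move=> SX p_le; rewrite -margin_le (margin_setID _ X S) (setIidPr SX).
by rewrite margin_revenue gerDl margin_le0.
Qed.

(** Otherwise adding i would give a larger assortment without losing revenue,
    against the choice of the largest one. *)
Lemma price_lt_expanded A i :
  i \notin expanded_set p v A -> p i < expanded_revenue p v A.
Proof.
have [AE RE maxE] := expanded_setP p v A.
set E := expanded_set p v A in AE RE maxE * => iE; rewrite ltNge -RE.
apply/negP => pi_ge.
have AiE : A \subset i |: E by rewrite subsetU // AE orbT.
have RiE : revenue p v (i |: E) = expanded_revenue p v A.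
  apply/eqP; rewrite eq_le revenue_le_expanded //= -RE -margin_ge.
  by rewrite margin_setU1 // margin_revenue lerDr mulr_ge0 ?subr_ge0 // ltW.
by have := maxE _ AiE RiE; rewrite cardsU1 iE add1n ltnn.
Qed.

(** With r = R(S), any other superset of A differs from S by dropping products
    with p_i - r >= 0 and adding products with p_i - r < 0.  Neither increases
    the margin, and the second strictly decreases it, so that S is both
    optimal and the largest optimal superset. *)
Lemma expanded_set_threshold A S :
  A \subset S ->
  (forall i, i \in S :\: A -> revenue p v S <= p i) ->
  (forall i, i \notin S -> p i < revenue p v S) ->
  S = expanded_set p v A.
Proof.
move=> AS p_in p_out; have [AE RE maxE] := expanded_setP p v A.
set E := expanded_set p v A in AE RE maxE *; set r := revenue p v S.
have margin_sub X : A \subset X -> margin r X <= r + margin r (X :\: S).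
  move=> AX; rewrite (margin_setID _ X S) lerD2r -[leRHS]margin_revenue -/r.
  rewrite [leRHS](margin_setID _ S X) setIC lerDl margin_ge0 // => i.
  rewrite inE => /andP[iX iS]; apply: p_in; rewrite inE iS andbT.
  by apply: contraNN iX => /(subsetP AX).
have out_le X i : i \in X :\: S -> p i <= r.
  by rewrite inE => /andP[/p_out/ltW].
have rE : expanded_revenue p v A = r.
  apply/eqP; rewrite eq_le revenue_le_expanded // andbT -RE -margin_le.
  by rewrite (le_trans (margin_sub _ AE)) // gerDl margin_le0 // => i /out_le.
have ES : E \subset S.
  apply/subsetP => i iE; apply/negPn/negP => iS.
  have iD : i \in E :\: S by rewrite inE iS.
  suff : margin r E < r by rewrite ltNge margin_ge RE rE lexx.
  apply: le_lt_trans (margin_sub _ AE) _; rewrite gtrDl.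
  rewrite /margin (big_setD1 _ iD) /= ltr_wnDr //.
    by apply: margin_le0 => j; rewrite inE => /andP[_ /out_le].
  by rewrite nmulr_rlt0 // subr_lt0 p_out.
by apply/eqP; rewrite eq_sym eqEcard ES maxE.
Qed.

Lemma expanded_revenue_antitone A B :
  A \subset B -> expanded_revenue p v B <= expanded_revenue p v A.
Proof.
have [BE <- _] := expanded_setP p v B => AB.
exact/revenue_le_expanded/(subset_trans AB).
Qed.

(** Let D be the set of the products of S outside X.  Adding D to the
    intersection turns it into S, adding D to X turns it into the union; the
    second addition costs less.  Indeed an addition of D to a set of revenue y
    and weight b changes its revenue by (N - y w) / (b + w), where N and w are
    the value and the weight of D.  The intersection has at least the revenue
    of X, as the products of D pull the revenue of S down, and it has at most
    the weight of X. *)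
Lemma revenue_uncross S X :
  revenue p v X <= revenue p v S ->
  (forall i, i \in S :\: X -> p i <= revenue p v X) ->
  revenue p v S + revenue p v X <= revenue p v (S :|: X) + revenue p v (S :&: X).
Proof.
set x := revenue p v X => xS p_le.
(* Removing from S the products of D, priced at most x, keeps its revenue at least x. *)
have xI : x <= revenue p v (S :&: X).
  rewrite -margin_ge; move: xS; rewrite -margin_ge (margin_setID _ S X).
  by move=> /le_trans -> //; rewrite gerDl margin_le0.
have sumS f : \sum_(i in S) f i =
    \sum_(i in S :&: X) f i + \sum_(i in S :\: X) f i :> R by exact: big_setID.
have sumU f : \sum_(i in S :|: X) f i =
    \sum_(i in X) f i + \sum_(i in S :\: X) f i :> R.
  by rewrite (big_setID X) /= setIC setKU setDUl setDv setU0.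
have D_le : margin x (S :\: X) <= 0 by apply: margin_le0.
have wI := weight_gt0 (S :&: X); have wX := weight_gt0 X.
have wIX : 1 + \sum_(i in S :&: X) v i <= 1 + \sum_(i in X) v i.
  rewrite lerD2l [leRHS](big_setID S) /= setIC lerDl sumr_ge0 // => i _.
  exact: ltW.
have wD : 0 <= \sum_(i in S :\: X) v i.
  by apply: sumr_ge0 => i _; apply: ltW.
have NX : \sum_(i in X) p i * v i = x * (1 + \sum_(i in X) v i).
  by rewrite divfK // gt_eqF.
have NI : \sum_(i in S :&: X) p i * v i =
    revenue p v (S :&: X) * (1 + \sum_(i in S :&: X) v i).
  by rewrite divfK // gt_eqF.
move: D_le; rewrite marginE [revenue p v S]/revenue !sumS NI.
rewrite [revenue p v (S :|: X)]/revenue !sumU NX.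
move: xI wI wX wIX wD; move: (revenue _ _ (S :&: X)).
move: (\sum_(i in S :\: X) p i * v i) (\sum_(i in S :\: X) v i) => d w.
rewrite !addrA; move: (1 + _) (1 + _) => e b y xy b0 e0 be w0 dxw.
have -> : (y * b + d) / (b + w) = y + (d - y * w) / (b + w).
  by field; rewrite gt_eqF // ltr_wpDr.
have -> : (x * e + d) / (e + w) = x + (d - x * w) / (e + w).
  by field; rewrite gt_eqF // ltr_wpDr.
rewrite addrAC [leRHS]addrAC [x + y]addrC lerD2l.
apply: (@le_trans _ _ ((d - x * w) / (b + w))).
  rewrite ler_pM2r ?invr_gt0 ?ltr_wpDr // lerD2l lerN2.
  by rewrite ler_wpM2r.
rewrite ler_wnM2l // lef_pV2 ?posrE ?ltr_wpDr // lerD2r //.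
Qed.

Lemma expanded_revenue_supermodular A B :
  expanded_revenue p v A + expanded_revenue p v B <=
  expanded_revenue p v (A :|: B) + expanded_revenue p v (A :&: B).
Proof.
wlog le_BA : A B / expanded_revenue p v B <= expanded_revenue p v A.
  move=> IH; case: (leP (expanded_revenue p v B) (expanded_revenue p v A)).
    exact: IH.
  by move=> /ltW/IH; rewrite setUC setIC addrC.
have [AE RA _] := expanded_setP p v A; have [BE RB _] := expanded_setP p v B.
have D_le i : i \in expanded_set p v A :\: expanded_set p v B ->
    p i <= revenue p v (expanded_set p v B).
  by rewrite inE RB => /andP[/price_lt_expanded/ltW].
have := revenue_uncross _ D_le; rewrite RA RB => /(_ le_BA)/le_trans; apply.
by apply: lerD; apply: revenue_le_expanded; [apply: setUSS|apply: setISS].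
Qed.

End Revenue.

(** * Superlevel sets of a family of sets *)

Section LevelSets.

Variables (I : finType) (S : nat -> {set I}).

Definition multiplicity m (i : I) : nat := \sum_(1 <= t < m.+1) (i \in S t).

Definition superlevel m j : {set I} := [set i | (j <= multiplicity m i)%N].

Lemma multiplicityS m i :
  multiplicity m.+1 i = (multiplicity m i + (i \in S m.+1))%N.
Proof. by rewrite /multiplicity big_nat_recr. Qed.

Lemma multiplicity_le m i : (multiplicity m i <= m)%N.
Proof.
by elim: m => [|m IH]; [rewrite /multiplicity big_nil
  | rewrite multiplicityS -addn1 leq_add // leq_b1].
Qed.

Lemma superlevelS m j :
  superlevel m.+1 j.+1 = (S m.+1 :&: superlevel m j) :|: superlevel m j.+1.
Proof. by apply/setP=> i; rewrite !inE multiplicityS; case: (_ \in _) => /=; lia. Qed.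

Lemma superlevel0 m : superlevel m 0 = setT.
Proof. by apply/setP => i; rewrite !inE. Qed.

Lemma superlevel_gt m : superlevel m m.+1 = set0.
Proof. by apply/setP => i; rewrite !inE ltnNge multiplicity_le. Qed.

(** The set S_(m+1) is inserted into the chain of superlevel sets from its
    largest member on: at each member the current set is replaced by its
    intersection with the member, and the member by the union of both.
    Supermodularity bounds the change of the total at each exchange, and what
    is left at the end is the new smallest superlevel set. *)
Lemma supermodular_superlevel (R : realFieldType) (f : {set I} -> R) m :
  (forall A B, f A + f B <= f (A :|: B) + f (A :&: B)) ->
  \sum_(1 <= t < m.+1) f (S t) <= \sum_(1 <= j < m.+1) f (superlevel m j).
Proof.
move=> f_super; elim: m => [|m IH]; first by rewrite !big_nil.
have insert k : \sum_(1 <= j < k.+1) f (superlevel m j) + f (S m.+1) <=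
    \sum_(1 <= j < k.+1) f (superlevel m.+1 j) + f (S m.+1 :&: superlevel m k).
  elim: k => [|k IHk]; first by rewrite !big_nil superlevel0 setIT.
  rewrite !(@big_nat_recr _ _ _ k.+1) //= superlevelS.
  have := f_super (S m.+1 :&: superlevel m k) (superlevel m k.+1).
  rewrite -setIA (_ : superlevel m k :&: _ = superlevel m k.+1); first by lra.
  by apply/setIidPr/subsetP => i; rewrite !inE; apply: ltnW.
rewrite big_nat_recr //= [leRHS]big_nat_recr //= superlevelS superlevel_gt setU0.
by apply: le_trans (insert m); rewrite lerD2r.
Qed.

End LevelSets.

(** * Optimality of the expanded sets *)

Section Optimality.

Variables (R : realFieldType) (n T : nat) (p v : 'I_n -> R) (l : 'I_n -> nat).
Hypothesis v_gt0 : forall i, 0 < v i.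
Hypothesis l_le : forall i, (l i <= T)%N.

Lemma bigcup_level t :
  \bigcup_(t <= u < T.+1) level l u = [set i | (t <= l i)%N].
Proof.
apply/setP => i; rewrite inE; apply/idP/idP.
  rewrite big_nat; elim/big_ind: _ => [|X Y IHX IHY|u /andP[tu _]].
  - by rewrite inE.
  - by rewrite inE => /orP[].
  by rewrite inE => /eqP ->.
move=> tl; rewrite (big_cat_nat tl (leqW (l_le i))) /= inE.
by rewrite (@big_ltn _ _ _ (l i)) ?ltnS ?l_le // !inE eqxx orbT.
Qed.

Lemma opt_assortmentE t :
  opt_assortment T p v l t = expanded_set p v [set i | (t <= l i)%N].
Proof. by rewrite /opt_assortment bigcup_level. Qed.

Lemma opt_assortment_feasible : apv_feasible T l (opt_assortment T p v l).
Proof.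
move=> i; rewrite (big_cat_nat (n := (l i).+1)) ?ltnS ?l_le //=.
apply: leq_trans (leq_addr _ _).
rewrite (eq_big_nat _ _ (F2 := fun=> 1%N)); first by rewrite sum_nat_const_nat; lia.
move=> t /andP[_]; rewrite ltnS opt_assortmentE => tl.
have [/subsetP sub _ _] := expanded_setP p v [set i | (t <= l i)%N].
by rewrite sub ?inE.
Qed.

Lemma opt_assortment_optimal : apv_optimal T p v l (opt_assortment T p v l).
Proof.
split=> [|S feasS]; first exact: opt_assortment_feasible.
apply: (@le_trans _ _ (\sum_(1 <= t < T.+1) expanded_revenue p v (S t))).
  by apply: ler_sum => t _; apply: revenue_le_expanded.
have super := expanded_revenue_supermodular p v_gt0.
apply: (le_trans (supermodular_superlevel S T super)).
apply: ler_sum => t _; rewrite opt_assortmentE.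
have [_ -> _] := expanded_setP p v [set i | (t <= l i)%N].
apply/expanded_revenue_antitone/subsetP => i.
by rewrite !inE => /leq_trans -> //; apply: feasS.
Qed.

End Optimality.

(** * Executing programs *)

Section Execution.

Variable R : realFieldType.
Implicit Types (c : prog) (s : state R) (b : test).

Fixpoint loop_free c : bool :=
  match c with
  | Skip | Instr _ => true
  | Seq c1 c2 | If _ c1 c2 => loop_free c1 && loop_free c2
  | While _ _ => false
  end.

(** Both branches of a test are counted, which bounds the running time of a
    loop-free program independently of the state. *)
Fixpoint cost c : nat :=
  match c with
  | Skip | Instr _ => 1
  | Seq c1 c2 => cost c1 + cost c2
  | If _ c1 c2 => (cost c1 + cost c2).+1
  | While _ _ => 0
  end.

(** The final state of a loop-free program.  The value at a loop is
    arbitrary. *)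
Fixpoint exec c s : state R :=
  match c with
  | Skip | While _ _ => s
  | Instr i => step i s
  | Seq c1 c2 => exec c2 (exec c1 s)
  | If b c1 c2 => if holds b s then exec c1 s else exec c2 s
  end.

Lemma runs_loop_free c s :
  loop_free c -> exists2 k, (k <= cost c)%N & runs c s k (exec c s).
Proof.
elim: c s => [|i|c1 IH1 c2 IH2|b c1 IH1 c2 IH2|//] s /=.
- by exists 1%N => //; apply: runs_skip.
- by exists 1%N => //; apply: runs_instr.
- move=> /andP[/(IH1 s)[k1 le1 run1] /(IH2 (exec c1 s))[k2 le2 run2]].
  by exists (k1 + k2)%N; [apply: leq_add|apply: runs_seq run1 run2].
move=> /andP[/(IH1 s)[k1 le1 run1] /(IH2 s)[k2 le2 run2]].
case: ifPn => bs.
  by exists k1.+1; [rewrite ltnS (leq_trans le1) ?leq_addr|apply: runs_if_true].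
by exists k2.+1; [rewrite ltnS (leq_trans le2) ?leq_addl|apply: runs_if_false].
Qed.

(** Running time and partial correctness of a loop together: the index of the
    invariant is a bound for the number of iterations to come. *)
Lemma runs_while (Inv : nat -> state R -> Prop) b c :
  loop_free c ->
  (forall j s, Inv j s -> holds b s ->
     exists2 j', (j' < j)%N & Inv j' (exec c s)) ->
  forall j s, Inv j s ->
  exists k s', [/\ runs (While b c) s k s', (k <= (cost c).+1 * j + 1)%N,
                   ~~ holds b s' & exists j', Inv j' s'].
Proof.
move=> lfc body; elim/ltn_ind => j IH s Is.
have [bs|bs] := boolP (holds b s); last first.
  by exists 1%N, s; split; [apply: runs_while_false|lia|by []|exists j].
have [j' lt_j' Is'] := body _ _ Is bs.
have [k1 le1 run1] := runs_loop_free s lfc.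
have [k2 [s' [run2 le2 bs' Is'']]] := IH _ lt_j' _ Is'.
exists (k1 + k2).+1, s'; split=> //; first exact: runs_while_true run1 run2.
apply: (@leq_trans ((cost c).+1 * j'.+1 + 1)); last first.
  by rewrite leq_add2r leq_mul2l lt_j' orbT.
by rewrite mulnS; lia.
Qed.

End Execution.

(** * A linear-time program *)

Definition block (cs : seq instr) : prog :=
  foldr (fun i c => Seq (Instr i) c) Skip cs.

(** Integer registers: 2 is the product index m, 3 the level t, 4 constantly 0,
    5 the level of the current product.  Real registers: 0 and 1 are the
    numerator and the denominator of the current revenue; 2, 3, 4 hold p_m,
    v_m and p_m v_m, or in 4 the product of p_m and the denominator; 5 is
    scratch.  Real arrays 2 and 3 hold, for each level, the total of p_i v_i
    and of v_i.

    This loop body adds product m to the totals of its level and initialises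
    its output count to l_m. *)
Definition tally : prog := block
  [:: NLoad 5 0 2; NStore 1 2 5;
      RLoad 2 0 2; RLoad 3 1 2; RMul 4 2 3;
      RLoad 5 2 5; RAdd 5 5 4; RStore 2 5 5;
      RLoad 5 3 5; RAdd 5 5 3; RStore 3 5 5;
      NSucc 2 2].

(** The walk starts at t = T + 1, where no product is required, so that level T
    is entered like all others. *)
Definition start_sweep : prog := block
  [:: NConst 2 0; NSucc 3 1; RZero 0; ROne 1].

(** Product m joins the current assortment: its output count becomes t, and it
    leaves the totals of its level, since it must not be counted again when
    that level is reached. *)
Definition absorb : prog := block
  [:: NStore 1 2 3;
      RLoad 2 0 2; RLoad 3 1 2; RMul 4 2 3; RAdd 0 0 4; RAdd 1 1 3;
      RLoad 5 2 5; RSub 5 5 4; RStore 2 5 5;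
      RLoad 5 3 5; RSub 5 5 3; RStore 3 5 5].

Definition advance : prog :=
  Seq (Instr (NLoad 5 0 2))
    (Seq (If (NLt 5 3) absorb Skip) (Instr (NSucc 2 2))).

Definition descend : prog := block
  [:: NPred 3 3; RLoad 5 2 3; RAdd 0 0 5; RLoad 5 3 3; RAdd 1 1 5].

(** The test whether p_m is at least the current revenue is made without
    division, on p_m times the denominator. *)
Definition sweep : prog :=
  Seq (block [:: RLoad 2 0 2; RMul 4 2 1])
    (If (NLt 2 0) (If (RLe 0 4) advance descend) descend).

Definition apv_prog : prog :=
  Seq (While (NLt 2 0) tally) (Seq start_sweep (While (NLt 4 3) sweep)).

(** * Correctness of the program *)

Section Correctness.

Variables (R : realFieldType) (n T : nat) (p v : 'I_n -> R) (l : 'I_n -> nat).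
Hypothesis p_noninc : forall i j : 'I_n, (i <= j)%N -> p j <= p i.
Hypothesis v_gt0 : forall i, 0 < v i.
Hypothesis l_le : forall i, (l i <= T)%N.

Implicit Types (s : state R) (t m u : nat) (i : 'I_n) (P : pred 'I_n).

Definition pv i := p i * v i.

Definition swept t m : {set 'I_n} := [set i | (t <= l i)%N || (i < m)%N].

Lemma sweptS_old t i : (t <= l i)%N -> swept t i.+1 = swept t i.
Proof.
move=> tl; apply/setP => j; rewrite !inE ltnS (leq_eqVlt j).
by case: eqP => //= /ord_inj ->; rewrite tl.
Qed.

Lemma sweptS t i : swept t i.+1 = i |: swept t i.
Proof.
by apply/setP => j; rewrite !inE ltnS (leq_eqVlt j) orbCA.
Qed.

Lemma sum_swept_descend (f : 'I_n -> R) t m :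
  \sum_(i in swept t m) f i =
  \sum_(i in swept t.+1 m) f i + \sum_(i | (l i == t) && (m <= i)%N) f i.
Proof.
rewrite (big_setID (swept t.+1 m)) /=; congr (_ + _); apply: eq_bigl => i;
  rewrite !inE; lia.
Qed.

Lemma swept_descend_sub t m : swept t.+1 m \subset swept t m.
Proof. by apply/subsetP => i; rewrite !inE => /orP[/ltnW ->|->]; rewrite ?orbT. Qed.

Lemma sum_tally (f : 'I_n -> R) u i :
  \sum_(j | (l j == u) && (j < i.+1)%N) f j =
  \sum_(j | (l j == u) && (j < i)%N) f j + (if u == l i then f i else 0).
Proof.
case: eqP => [->|ne].
  rewrite (bigD1 i) ?eqxx ?ltnS ?leqnn //= addrC; congr (_ + _).
  by apply: eq_bigl => j; rewrite -(inj_eq val_inj j i) /=; lia.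
rewrite addr0; apply: eq_bigl => j; rewrite ltnS (leq_eqVlt j).
by case: (j =P i :> nat) => //= /ord_inj ->; case: eqP ne => // ->.
Qed.

Lemma sum_untally (f : 'I_n -> R) u i :
  \sum_(j | (l j == u) && (i.+1 <= j)%N) f j =
  \sum_(j | (l j == u) && (i <= j)%N) f j - (if u == l i then f i else 0).
Proof.
case: eqP => [->|ne].
  rewrite [X in _ = X - _](bigD1 i) ?eqxx ?leqnn //= addrC addrK.
  by apply: eq_bigl => j; rewrite -(inj_eq val_inj j i) /=; lia.
rewrite subr0; apply: eq_bigl => j; rewrite [(i <= j)%N]leq_eqVlt.
by case: (i =P j :> nat) => //= /ord_inj <-; case: eqP ne => // ->.
Qed.

(** The prefix belongs to the expanded set of {i | t <= l_i}: it has only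
    products that do not lower the revenue of the current assortment. *)
Definition bounded t m : Prop :=
  forall i, (i < m)%N -> revenue p v (swept t m) <= p i.

(** A price of at least the revenue stays so when its product is added, and
    the products before i are no cheaper. *)
Lemma bounded_advance t i :
  revenue p v (swept t i) <= p i -> bounded t i.+1.
Proof.
move=> Ri j; rewrite ltnS => ji; apply: le_trans (p_noninc ji).
by rewrite sweptS revenue_setU1_le.
Qed.

(** When no product beyond the prefix reaches the current revenue, the
    products of level t that enter do not either, so they lower it; hence
    [bounded] survives a decrease of t. *)
Lemma revenue_descend t m :
  (forall i, (m <= i)%N -> p i <= revenue p v (swept t.+1 m)) ->
  revenue p v (swept t m) <= revenue p v (swept t.+1 m).
Proof.
move=> stop; apply: revenue_superset_le (swept_descend_sub t m) _ => // i.
by rewrite !inE => /andP[i_new _]; apply: stop; lia.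
Qed.

Lemma swept_expanded t m :
  bounded t m -> (forall i, (m <= i)%N -> p i < revenue p v (swept t m)) ->
  opt_assortment T p v l t = swept t m.
Proof.
move=> bnd stop; rewrite opt_assortmentE //; symmetry.
apply: expanded_set_threshold => // [|i|i].
- by apply/subsetP => i; rewrite !inE => ->.
- by rewrite !inE => /andP[/negPf ->]; apply: bnd.
by rewrite !inE => i_out; apply: stop; lia.
Qed.

Definition input_kept s : Prop :=
  [/\ nreg s 0 = n, nreg s 4 = 0%N, narr s 0 = array_of 0%N l,
      rarr s 0 = array_of 0 p & rarr s 1 = array_of 0 v].

Definition bucketed P s u : Prop :=
  rarr s 2 u = \sum_(i | (l i == u) && P i) pv i /\
  rarr s 3 u = \sum_(i | (l i == u) && P i) v i.

Lemma array_ofE (X : Type) (x0 : X) (f : 'I_n -> X) i : array_of x0 f i = f i.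
Proof. by rewrite /array_of valK. Qed.

(** The index j counts the products still to be tallied. *)
Definition tally_inv j s : Prop :=
  [/\ input_kept s, nreg s 1 = T, (nreg s 2 + j)%N = n,
      forall i, (i < nreg s 2)%N -> narr s 1 i = l i
    & forall u, bucketed (fun i => i < nreg s 2)%N s u].

Lemma tally_step j s :
  tally_inv j s -> holds (NLt 2 0) s ->
  exists2 j', (j' < j)%N & tally_inv j' (exec tally s).
Proof.
move=> [[n_s z_s l_s p_s v_s] T_s mj c_s b_s] /=; rewrite n_s => m_lt.
have [i m_i] : exists i : 'I_n, nreg s 2 = i by exists (Ordinal m_lt).
exists j.-1; first by lia.
split=> //=; rewrite /bucketed /= /update /=.
- by lia.
- move=> k; rewrite m_i ltnS (leq_eqVlt k) l_s array_ofE.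
  by case: eqP => [/ord_inj -> //|_ /= lt_ki]; rewrite c_s ?m_i.
move=> u; have [b2 b3] := b_s u; have [b2l b3l] := b_s (l i).
rewrite m_i l_s p_s v_s !array_ofE !sum_tally.
by rewrite b2 b3 b2l b3l m_i -/(pv i); case: eqP => [->|]; rewrite ?addr0.
Qed.

(** Beyond the prefix the counts are still l_i.  In the prefix their final
    value is known only to be at least t, which already determines the
    assortments of the levels above t. *)
Definition sweep_counts s : Prop :=
  [/\ forall i, (nreg s 2 <= i)%N -> narr s 1 i = l i,
      forall i, (i < nreg s 2)%N -> (nreg s 3 <= narr s 1 i)%N
    & forall t, (nreg s 3 < t <= T)%N ->
        output_assortment n s t = opt_assortment T p v l t].

Definition sweep_sums s : Prop :=
  [/\ rreg s 0 = \sum_(i in swept (nreg s 3) (nreg s 2)) pv i,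
      rreg s 1 = 1 + \sum_(i in swept (nreg s 3) (nreg s 2)) v i
    & forall u, (u < nreg s 3)%N -> bucketed (fun i => nreg s 2 <= i)%N s u].

(** The index j is the number of moves left: at most n - m advances and t
    descents. *)
Definition sweep_inv j s : Prop :=
  [/\ (n - nreg s 2 + nreg s 3)%N = j, input_kept s, sweep_sums s,
      sweep_counts s & bounded (nreg s 3) (nreg s 2)].

Lemma advance_step j s i :
  sweep_inv j s -> nreg s 2 = i ->
  revenue p v (swept (nreg s 3) i) <= p i ->
  exists2 j', (j' < j)%N & sweep_inv j' (exec advance s).
Proof.
move=> [mj [n_s z_s l_s p_s v_s] [N_s W_s b_s] [c_new c_old c_out] bnd] m_i Ri.
have i_n := ltn_ord i.
exists j.-1; first by lia.
have bnd' := bounded_advance Ri.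
have lE : narr s 0 (nreg s 2) = l i by rewrite l_s m_i array_ofE.
rewrite /advance /= lE /update /=; case: ltnP => [l_lt|l_ge].
  have i_out : i \notin swept (nreg s 3) i by rewrite inE ltnn; lia.
  have [bl2 bl3] := b_s _ l_lt.
  split=> //=; rewrite /update /= ?m_i.
  - by lia.
  - rewrite /sweep_sums /bucketed /= /update /= ?m_i p_s v_s !array_ofE -/(pv i).
    split.
    + by rewrite sweptS big_setU1 //= N_s m_i addrC.
    + by rewrite sweptS big_setU1 //= W_s m_i addrCA addrC.
    move=> u /b_s[b2 b3]; rewrite !sum_untally b2 b3 bl2 bl3 m_i.
    by case: eqP => [->|]; rewrite ?subr0.
  - split=> /= [k|k|t]; rewrite /update /= ?m_i.
    + by move=> ik; rewrite gtn_eqF // c_new // m_i ltnW.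
    + rewrite ltnS (leq_eqVlt k); case: eqP => //= _ ki.
      by rewrite c_old ?m_i.
    move=> tT; rewrite -c_out //; apply/setP => k; rewrite !inE /= /update /=.
    case: eqP => // /ord_inj ->; rewrite c_new ?m_i //; lia.
  exact: bnd'.
split=> //=; rewrite /update /= ?m_i.
- by lia.
- rewrite /sweep_sums /bucketed /= /update /= ?m_i sweptS_old //.
  rewrite N_s W_s m_i; split=> // u u_lt; have [-> ->] := b_s _ u_lt.
  rewrite !sum_untally m_i; case: eqP => [uE|_]; last by rewrite !subr0.
  by move: u_lt; rewrite uE; lia.
- split=> /= [k|k|t]; rewrite /update /= ?m_i.
  + by move=> ik; rewrite c_new // m_i ltnW.
  + rewrite ltnS (leq_eqVlt k); case: eqP => [/ord_inj -> _|_ /= ki].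
      by rewrite c_new ?m_i.
    by rewrite c_old ?m_i.
  by move=> tT; rewrite -c_out.
exact: bnd'.
Qed.

(** The current assortment is final for level t, because its prefix satisfies
    [bounded] and no further product reaches its revenue. *)
Lemma descend_step j s :
  sweep_inv j s -> (0 < nreg s 3)%N ->
  (forall i, (nreg s 2 <= i)%N ->
     p i < revenue p v (swept (nreg s 3) (nreg s 2))) ->
  exists2 j', (j' < j)%N & sweep_inv j' (exec descend s).
Proof.
move=> [mj inp [N_s W_s b_s] [c_new c_old c_out] bnd] t_gt0 stop.
exists j.-1; first by lia.
have t_out : output_assortment n s (nreg s 3) = opt_assortment T p v l (nreg s 3).
  rewrite (swept_expanded bnd stop); apply/setP => i; rewrite !inE.
  by case: ltnP => [/c_old ->|/c_new ->]; rewrite ?orbT ?orbF.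
case t_s: (nreg s 3) t_gt0 => [//|t] _.
rewrite t_s in N_s W_s b_s c_out c_old bnd stop t_out mj.
have [b2 b3] := b_s _ (ltnSn t).
split=> //=; rewrite /update /= ?t_s /=.
- by lia.
- rewrite /sweep_sums /bucketed /= /update /= ?t_s /= N_s W_s b2 b3.
  rewrite !(sum_swept_descend _ t) addrA; split=> // u u_lt.
  by apply: b_s; apply: ltnW.
- split=> /= [k|k|u]; rewrite /update /= ?t_s /=.
  + exact: c_new.
  + by move=> /c_old/ltnW.
  move=> /andP[]; rewrite (leq_eqVlt t.+1) => /orP[/eqP <- _|tu uT].
    exact: t_out.
  by apply: c_out; rewrite tu.
move=> i im; apply: le_trans (bnd _ im); apply: revenue_descend => k mk.
exact/ltW/stop.
Qed.

Lemma sweep_step j s :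
  sweep_inv j s -> holds (NLt 4 3) s ->
  exists2 j', (j' < j)%N & sweep_inv j' (exec sweep s).
Proof.
move=> inv; have [_ [n_s z_s _ p_s _] [N_s W_s _] _ _] := inv.
have RE : revenue p v (swept (nreg s 3) (nreg s 2)) = rreg s 0 / rreg s 1.
  by rewrite N_s W_s.
have W_gt0 : 0 < rreg s 1 by rewrite W_s weight_gt0.
rewrite [holds _ _]/= z_s => t_gt0.
set s' := exec (block [:: RLoad 2 0 2; RMul 4 2 1]) s.
have inv' : sweep_inv j s' by exact: inv.
have -> : exec sweep s =
    if (nreg s 2 < nreg s 0)%N then
      if rreg s 0 <= rarr s 0 (nreg s 2) * rreg s 1 then exec advance s'
      else exec descend s'
    else exec descend s' by [].
rewrite n_s; case: ltnP => [m_lt|m_ge]; last first.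
  apply: (descend_step inv') => // i /(leq_trans m_ge).
  by rewrite leqNgt ltn_ord.
have [i m_i] : exists i : 'I_n, nreg s 2 = i by exists (Ordinal m_lt).
rewrite p_s m_i array_ofE -ler_pdivrMr // -RE m_i.
case: leP => Ri; first exact: (advance_step inv' m_i).
apply: (descend_step inv') => // k; rewrite /= m_i => ik.
exact: le_lt_trans (p_noninc ik) _.
Qed.

Lemma start_inv s j :
  tally_inv j s -> ~~ holds (NLt 2 0) s ->
  sweep_inv (n + T.+1) (exec start_sweep s).
Proof.
move=> [inp T_s mj c_s b_s]; have [n_s _ _ _ _] := inp.
rewrite /= n_s -leqNgt => m_ge.
have swept0 : swept T.+1 0 = set0.
  by apply/setP => i; rewrite !inE ltn0 orbF ltnNge l_le.
split=> //=; rewrite /update /= ?T_s.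
- by rewrite subn0.
- rewrite /sweep_sums /bucketed /= /update /= ?T_s swept0 !big_set0 addr0.
  split=> // u _; have [-> ->] := b_s u.
  by split; apply: eq_bigl => i; rewrite (leq_trans (ltn_ord i)).
split=> /= [k _|//|t]; rewrite /update /=.
  by rewrite c_s // (leq_trans (ltn_ord k)).
lia.
Qed.

Lemma apv_prog_correct : (1 <= T)%N ->
  exists k s,
    [/\ runs apv_prog (input_state T p v l) k s,
        (k <= 100 * (n + T))%N
      & forall t, (1 <= t <= T)%N ->
          output_assortment n s t = opt_assortment T p v l t].
Proof.
move=> T_gt0.
have inv0 : tally_inv n (input_state T p v l).
  by split=> //= u; split; rewrite /= big_pred0 // => i; rewrite andbF.
have [k1 [s1 [run1 le1 out1 [j1 inv1]]]] :=
  runs_while (isT : loop_free tally) tally_step inv0.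
have [k2 le2 run2] := runs_loop_free s1 (isT : loop_free start_sweep).
have [k3 [s3 [run3 le3 out3 [j3 inv3]]]] :=
  runs_while (isT : loop_free sweep) sweep_step (start_inv inv1 out1).
exists (k1 + (k2 + k3))%N, s3; split.
- exact/(runs_seq run1)/(runs_seq run2).
- by move: le1 le2 le3 => /=; lia.
have [_ [_ z_s _ _ _] _ [_ _ c_out] _] := inv3.
move: out3; rewrite /= z_s -leqNgt leqn0 => /eqP t0 t t_bd.
by apply: c_out; rewrite t0.
Qed.

End Correctness.

Theorem theorem3p7 :
  (forall (R : realFieldType) (n T : nat) (p v : 'I_n -> R) (l : 'I_n -> nat),
     apv_instance T p v l ->
     apv_optimal T p v l (opt_assortment T p v l))
  /\
  (exists (P : prog) (C : nat),
     forall (R : realFieldType) (n T : nat) (p v : 'I_n -> R) (l : 'I_n -> nat),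
       apv_instance T p v l ->
       exists (k : nat) (s : state R),
         [/\ runs P (input_state T p v l) k s,
             (k <= C * (n + T))%N
           & forall t : nat, (1 <= t <= T)%N ->
               output_assortment n s t = opt_assortment T p v l t]).
Proof.
split=> [R n T p v l [_ _ _ v_gt0 l_le]|]; first exact: opt_assortment_optimal.
(* The loop bodies cost at most 40 steps each; 100 leaves room for the
   constant terms, as T >= 1. *)
exists apv_prog, 100%N => R n T p v l [T_gt0 p_noninc _ v_gt0 l_le].
exact: apv_prog_correct.
Qed.
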